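(* Let $G$ be a finite group, $F$ a field, and $V$ a faithful $G$-module over $F$. Assume that the characteristic $p>0$ of $F$ divides the group order $|G|$. Then \[ \lim_{m\to\infty} \operatorname{topdeg} F[V^{m}]_{G}=\infty. \]
   Context: A $G$-module is a finite-dimensional representation $V$ of the finite group $G$ over the field $F$; $V^m$ denotes the $m$-fold direct sum of $V$. $F[V]=S(V^* )$ is the symmetric algebra on the dual space, graded by degree, on which $G$ acts by $\sigma(f)=f\circ\sigma^{-1}$. $F[V]^G$ is the ring of invariants and $F[V]^G_+$ is the set of invariants with zero constant term. The Hilbert ideal is the ideal $I=F[V]^G_+F[V]$ of $F[V]$, and the algebra of coinvariants is the finite-dimensional graded algebra $F[V]_G=F[V]/I$. Its top degree $\operatorname{topdeg}F[V]_G$ is the largest degree in which $F[V]_G$ is non-zero. *)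

(* Defs.v *)
From HB Require Import structures.
From mathcomp Require Import all_boot all_order all_fingroup all_algebra.
From mathcomp Require Import all_character boolp mpoly.

Set Implicit Arguments.
Unset Strict Implicit.
Unset Printing Implicit Defensive.

Import GRing.Theory.
Import GroupScope.
Local Open Scope ring_scope.
Local Open Scope quotient_scope.

(* V is the space of column vectors F^n on which g acts by v |-> rG g *m v,
   and F[V] = S(V^* ) is {mpoly F[n]}, where 'X_i is the i-th coordinate
   function.  The substitution below sends 'X_i to 'X_i o g^-1, hence f to
   f o g^-1. *)
Definition inv_subst (F : fieldType) (gT : finGroupType) (G : {group gT})
    (n : nat) (rG : mx_representation F G n) (g : gT) : n.-tuple {mpoly F[n]} :=
  [tuple \sum_(j < n) rG g^-1%g i j *: 'X_j | i < n].

Definition poly_act (F : fieldType) (gT : finGroupType) (G : {group gT})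
    (n : nat) (rG : mx_representation F G n) (g : gT) (f : {mpoly F[n]}) :
    {mpoly F[n]} :=
  f \mPo inv_subst rG g.

Definition invariant (F : fieldType) (gT : finGroupType) (G : {group gT})
    (n : nat) (rG : mx_representation F G n) (f : {mpoly F[n]}) : bool :=
  [forall g in G, poly_act rG g f == f].

Definition invariant_plus (F : fieldType) (gT : finGroupType) (G : {group gT})
    (n : nat) (rG : mx_representation F G n) (f : {mpoly F[n]}) : bool :=
  invariant rG f && (f@_0%MM == 0).

Definition hilbert_ideal (F : fieldType) (gT : finGroupType) (G : {group gT})
    (n : nat) (rG : mx_representation F G n) : {pred {mpoly F[n]}} :=
  fun f => `[< exists (k : nat) (q h : 'I_k -> {mpoly F[n]}),
        (forall i, invariant_plus rG (h i)) /\ f = \sum_(i < k) q i * h i >].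

Lemma hilbert_ideal_closed (F : fieldType) (gT : finGroupType) (G : {group gT})
    (n : nat) (rG : mx_representation F G n) :
  idealr_closed (hilbert_ideal rG).
Proof.
split=> [||a u v].
- by apply/asboolP; exists 0%N, (fun=> 0), (fun=> 0); split=> [[]//|]; rewrite big_ord0.
- apply/negP => /asboolP[k [q [h [hh /(congr1 (mcoeff 0%MM))]]]].
  rewrite mcoeff1 eqxx raddf_sum big1 /= => [/eqP|i _]; first by rewrite oner_eq0.
  by rewrite rmorphM /=; case/andP: (hh i) => _ /eqP->; rewrite mulr0.
move=> /asboolP[k [q [h [hh ->]]]] /asboolP[l [r [s [hs ->]]]].
apply/asboolP; exists (k + l)%N.
exists (fun i => match split i with inl j => a * q j | inr j => r j end).
exists (fun i => match split i with inl j => h j | inr j => s j end).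
split=> [i|]; first by case: (split i).
rewrite big_split_ord mulr_sumr /=; congr (_ + _); apply: eq_bigr => i _.
  by case: split_ordP => j; [move/lshift_inj<-; rewrite mulrA | move/eqP; rewrite eq_lrshift].
by case: split_ordP => j; [move/eqP; rewrite eq_rlshift | move/rshift_inj<-].
Qed.

HB.instance Definition _ (F : fieldType) (gT : finGroupType) (G : {group gT})
    (n : nat) (rG : mx_representation F G n) :=
  isIdealr.Build {mpoly F[n]} (hilbert_ideal rG) (hilbert_ideal_closed rG).

Definition coinvariants (F : fieldType) (gT : finGroupType) (G : {group gT})
    (n : nat) (rG : mx_representation F G n) : comNzRingType :=
  {ideal_quot (hilbert_ideal rG)}.

Definition coinv_class (F : fieldType) (gT : finGroupType) (G : {group gT})
    (n : nat) (rG : mx_representation F G n) (f : {mpoly F[n]}) :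
    coinvariants rG :=
  \pi_({ideal_quot (hilbert_ideal rG)}) f.

(* The degree d component of F[V]_G is the image of that of F[V]. *)
Definition coinv_homog (F : fieldType) (gT : finGroupType) (G : {group gT})
    (n : nat) (rG : mx_representation F G n) (d : nat)
    (x : coinvariants rG) : Prop :=
  exists2 f : {mpoly F[n]}, f \is d.-homog & x = coinv_class rG f.

Definition coinv_nonzero_deg (F : fieldType) (gT : finGroupType)
    (G : {group gT}) (n : nat) (rG : mx_representation F G n) (d : nat) : bool :=
  `[< exists2 x : coinvariants rG, coinv_homog d x & x != 0 >].

Lemma coinv_class_eq0 (F : fieldType) (gT : finGroupType) (G : {group gT})
    (n : nat) (rG : mx_representation F G n) (f : {mpoly F[n]}) :
  (coinv_class rG f == 0) = hilbert_ideal rG f.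
Proof.
have := @Quotient.idealrBE _ (hilbert_ideal rG) f 0.
by rewrite subr0 /coinv_class rmorph0 => <-.
Qed.

Lemma coinv_nonzero_deg_exists (F : fieldType) (gT : finGroupType)
    (G : {group gT}) (n : nat) (rG : mx_representation F G n) :
  exists d, coinv_nonzero_deg rG d.
Proof.
exists 0%N; apply/asboolP; exists (coinv_class rG 1).
  by exists 1 => //; apply: dhomog1.
by rewrite coinv_class_eq0; case: (hilbert_ideal_closed rG).
Qed.

Lemma inv_substE (F : fieldType) (gT : finGroupType) (G : {group gT})
    (n : nat) (rG : mx_representation F G n) (g : gT) (i : 'I_n) :
  poly_act rG g 'X_i = \sum_(j < n) rG g^-1%g i j *: 'X_j.
Proof. by rewrite /poly_act comp_mpolyXU -tnth_nth tnth_mktuple. Qed.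

Lemma poly_act_comp (F : fieldType) (gT : finGroupType) (G : {group gT})
    (n : nat) (rG : mx_representation F G n) (g h : gT) (i : 'I_n) :
  g \in G -> h \in G ->
  poly_act rG h (poly_act rG g 'X_i) = poly_act rG (h * g)%g 'X_i.
Proof.
move=> Gg Gh; rewrite !inv_substE {1}/poly_act raddf_sum /=.
under eq_bigr => j _.
  rewrite linearZ /= -/(poly_act rG h 'X_j) inv_substE scaler_sumr.
  under eq_bigr => k _ do rewrite scalerA.
  over.
rewrite exchange_big /=; apply: eq_bigr => k _.
by rewrite invMg repr_mxM ?groupV // mxE scaler_suml.
Qed.

(* Each 'X_i is a root of the monic polynomial \prod_(g in G) (T - g 'X_i),
   all of whose lower coefficients are invariants without constant term. *)
Lemma hilbert_ideal_expX (F : fieldType) (gT : finGroupType) (G : {group gT})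
    (n : nat) (rG : mx_representation F G n) (i : 'I_n) :
  hilbert_ideal rG ('X_i ^+ #|G|).
Proof.
pose P : {poly {mpoly F[n]}} := \prod_(g in G) ('X - (poly_act rG g 'X_i)%:P).
have sP : size P = #|G|.+1 by rewrite /P -big_enum size_prod_XsubC -cardE.
have mP : P \is monic by apply: monic_prod => g _; apply: monicXsubC.
have P0 : P.['X_i] = 0.
  rewrite /P (bigD1 1%g) //= hornerM hornerXsubC inv_substE invg1 repr_mx1.
  rewrite (bigD1 i) //= mxE eqxx scale1r big1 ?addr0 ?subrr ?mul0r // => j ji.
  by rewrite mxE eq_sym (negPf ji) scale0r.
have invP k : invariant rG P`_k.
  apply/forall_inP => h Gh; apply/eqP.
  have -> : poly_act rG h P`_k = (map_poly (poly_act rG h) P)`_k.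
    by rewrite coef_map_id0 // /poly_act raddf0.
  have -> // : map_poly (poly_act rG h) P = P.
  rewrite -[poly_act rG h]/(comp_mpoly _) rmorph_prod /=.
  rewrite /P [RHS](reindex_inj (mulgI h)) /=; apply: eq_big => [g|g Gg].
    by rewrite groupMl.
  by rewrite rmorphB /= map_polyX map_polyC /= -poly_act_comp.
have constP k : (k < #|G|)%N -> (P`_k)@_0%MM = 0.
  move=> ltk; rewrite -(coef_map (mcoeff 0%MM)) rmorph_prod /=.
  rewrite (eq_bigr (fun=> 'X)) => [|g _]; first by rewrite prodr_const coefXn ltn_eqF.
  rewrite rmorphB /= map_polyX map_polyC /= inv_substE raddf_sum big1 ?subr0 //.
  by move=> j _ /=; rewrite mcoeffZ mcoeffX -mdeg_eq0 mdeg1 mulr0.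
apply/asboolP; exists #|G|.
exists (fun k : 'I_#|G| => - 'X_i ^+ k), (fun k : 'I_#|G| => P`_k).
split=> [k|]; first by rewrite /invariant_plus invP constP /=.
move: P0; rewrite horner_coef sP big_ord_recr /=.
have -> : P`_#|G| = 1 by move/monicP: mP; rewrite lead_coefE sP.
rewrite mul1r => /eqP; rewrite addrC addr_eq0 => /eqP ->.
by rewrite -sumrN; apply: eq_bigr => k _; rewrite mulNr mulrC.
Qed.

Lemma coinv_nonzero_deg_bounded (F : fieldType) (gT : finGroupType)
    (G : {group gT}) (n : nat) (rG : mx_representation F G n) (d : nat) :
  coinv_nonzero_deg rG d -> (d <= n * #|G|)%N.
Proof.
move=> /asboolP[x [f homf ->]]; apply: contraR; rewrite -ltnNge => ltd.
rewrite coinv_class_eq0 [f]mpolyE big_seq; apply: (@rpred_sum _ (hilbert_ideal rG)).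
move=> m mf; rewrite -mul_mpolyC; apply: idealMr.
have [i lei] : exists i, (#|G| <= m i)%N.
  apply/existsP; apply: contraLR ltd; rewrite negb_exists -leqNgt => /forallP lem.
  rewrite -(dhomog_mf homf mf) /= mdegE -[X in (_ <= X * _)%N]card_ord -sum_nat_const.
  by apply: leq_sum => i _; rewrite ltnW // ltnNge.
have -> : m = (m - U_(i) *+ #|G| + U_(i) *+ #|G|)%MM.
  apply/esym/submK/mnm_lepP => j; rewrite mulmnE mnm1E.
  by case: eqP => [<-|]; rewrite ?mul1n ?mul0n.
by rewrite mpolyXD -mpolyXn; apply/idealMr/hilbert_ideal_expX.
Qed.

Definition topdeg (F : fieldType) (gT : finGroupType) (G : {group gT})
    (n : nat) (rG : mx_representation F G n) : nat :=
  ex_maxn (coinv_nonzero_deg_exists rG) (@coinv_nonzero_deg_bounded _ _ _ _ rG).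

(* Main.v *)
From HB Require Import structures.
Require Import Defs.
From mathcomp Require Import all_boot all_order all_fingroup all_algebra.
From mathcomp Require Import all_solvable all_character boolp mpoly.

(** Choose g in G of order p (Cauchy).  In characteristic p the operator g - 1
    is nilpotent, since (g - 1)^p = g^p - 1 = 0, and it is nonzero because V is
    faithful; hence V contains vectors u and w != 0 with g u = u + w and
    g w = w ([pchar_has_shears]).  Placing copies u_j, w_j of them in each of
    the m summands of V^m gives a map W : F^m -> V^m, s |-> \sum_j s_j w_j, whose
    image consists of points fixed by g.

    The key point ([mderiv_pullback_shear]) is that the restriction f o W of an
    invariant f has all its partial derivatives equal to 0: differentiating
    f = f o g in the direction u_j at the fixed point W s, the derivatives along
    u_j and along g u_j = u_j + w_j agree, so the derivative along w_j, which
    is d(f o W)/ds_j, is zero.  A polynomial with zero gradient and zero constant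
    term has no squarefree monomial, and neither has any multiple of it
    ([coef_mul_mderiv0]).  So no element of the Hilbert ideal of V^m restricts
    along W to s_1 ... s_m.  As the w_j are linearly independent, some product of
    m linear forms on V^m does restrict to s_1 ... s_m; it is therefore nonzero in
    the coinvariants, and the top degree is at least m ([shears_topdeg]). *)

Set Implicit Arguments.
Unset Strict Implicit.
Unset Printing Implicit Defensive.

Import GRing.Theory.

Section LinearSubstitution.
Local Open Scope ring_scope.
Variable R : comNzRingType.

(** Identities between ring morphisms, or derivations, on polynomials need only
    be checked on constants and variables. *)
Lemma mpoly_alg_ind (n : nat) (P : {mpoly R[n]} -> Prop) :
    (forall c, P c%:MP) -> (forall i, P 'X_i) ->
    (forall f h, P f -> P h -> P (f + h)) ->
    (forall f h, P f -> P h -> P (f * h)) ->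
  forall f, P f.
Proof.
move=> PC PX PD PM; elim/mpolyind=> [|c m f _ _ Pf]; first by rewrite -mpolyC0.
apply: (PD _ _ _ Pf); rewrite -mul_mpolyC; apply: (PM _ _ (PC c)).
rewrite mpolyXE_id; elim/big_ind: _ => [||i _]; [by rewrite -mpolyC1|exact: PM|].
by elim: (m i) => [|k IHk]; rewrite ?expr0 -?mpolyC1 // exprS; apply: PM.
Qed.

(** The composite f o A, where A acts as a linear map R^n -> R^k on column
    vectors; for A = rG g^-1 this unfolds to [poly_act rG g]. *)
Definition pullback (k n : nat) (A : 'M[R]_(k, n)) (f : {mpoly R[k]}) :
    {mpoly R[n]} :=
  f \mPo [tuple \sum_(j < n) A i j *: 'X_j | i < k].

HB.instance Definition _ (k n : nat) (A : 'M[R]_(k, n)) :=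
  GRing.RMorphism.copy (@pullback k n A) (comp_mpoly _).
HB.instance Definition _ (k n : nat) (A : 'M[R]_(k, n)) :=
  GRing.Linear.copy (@pullback k n A) (comp_mpoly _).

Lemma pullbackC (k n : nat) (A : 'M[R]_(k, n)) c : pullback A c%:MP = c%:MP.
Proof. exact: comp_mpolyC. Qed.

Lemma pullbackX (k n : nat) (A : 'M[R]_(k, n)) (i : 'I_k) :
  pullback A 'X_i = \sum_(j < n) A i j *: 'X_j.
Proof. by rewrite /pullback comp_mpolyXU -tnth_nth tnth_mktuple. Qed.

Lemma pullback_comp (k l n : nat) (A : 'M[R]_(k, l)) (B : 'M[R]_(l, n)) f :
  pullback B (pullback A f) = pullback (A *m B) f.
Proof.
elim/mpoly_alg_ind: f => [c|i|f h IHf IHh|f h IHf IHh].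
- by rewrite !pullbackC.
- rewrite !pullbackX raddf_sum /=.
  under eq_bigr => j _ do rewrite linearZ /= pullbackX scaler_sumr.
  rewrite exchange_big /=; apply: eq_bigr => j _; rewrite mxE scaler_suml.
  by apply: eq_bigr => a _; rewrite scalerA.
- by rewrite !raddfD /= IHf IHh.
by rewrite !rmorphM /= IHf IHh.
Qed.

Lemma pullback_coef0 (k n : nat) (A : 'M[R]_(k, n)) f :
  (pullback A f)@_0 = f@_0.
Proof.
elim/mpoly_alg_ind: f => [c|i|f h IHf IHh|f h IHf IHh].
- by rewrite pullbackC !mcoeffC !eqxx.
- have cX0 q (j : 'I_q) : ('X_j : {mpoly R[q]})@_0 = 0.
    by rewrite mcoeffX -mdeg_eq0 mdeg1.
  rewrite pullbackX raddf_sum /= cX0 big1 // => j _.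
  by rewrite mcoeffZ cX0 mulr0.
- by rewrite !raddfD /= IHf IHh.
by rewrite !rmorphM /= IHf IHh.
Qed.

(** The chain rule for a linear substitution. *)
Lemma mderiv_pullback (k n : nat) (A : 'M[R]_(k, n)) (b : 'I_n) f :
  (pullback A f)^`M(b) = \sum_(a < k) A a b *: pullback A f^`M(a).
Proof.
have mdX q (i j : 'I_q) : ('X_i : {mpoly R[q]})^`M(j) = (i == j)%:R%:MP.
  rewrite mderivX mnm1E; case: eqP => [->|_]; last by rewrite scale0r mpolyC0.
  by rewrite -{1}[U_(j)%MM]add0m addmK mpolyX0 scale1r mpolyC1.
elim/mpoly_alg_ind: f => [c|i|f h IHf IHh|f h IHf IHh].
- rewrite pullbackC mderivC big1 // => a _.
  by rewrite mderivC raddf0 scaler0.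
- rewrite pullbackX raddf_sum (bigD1 b) //= (bigD1 i) //=.
  rewrite !mderivZ !mdX !eqxx pullbackC !big1 // => j jn.
    by rewrite mdX eq_sym (negPf jn) pullbackC mpolyC0 scaler0.
  by rewrite mderivZ mdX (negPf jn) mpolyC0 scaler0.
- rewrite raddfD /= mderivD IHf IHh -big_split.
  by apply: eq_bigr => a _; rewrite mderivD raddfD scalerDr.
rewrite rmorphM /= mderivM IHf IHh mulr_suml.
rewrite mulr_sumr -big_split; apply: eq_bigr => a _ /=.
rewrite mderivM raddfD /= !rmorphM /= scalerDr.
by rewrite -scalerAl -scalerAr.
Qed.

(** The columns of U are sheared by A along the fixed columns of W.  With D the
    gradient of f at the points of the image of W, the chain rule applied to
    f = f o A gives D = A^T D there, as A fixes these points.  Pairing with the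
    j-th column of U yields <u_j, D> = <A u_j, D> = <u_j, D> + <w_j, D>, so
    <w_j, D>, which is the j-th partial derivative of f o W, vanishes. *)
Lemma mderiv_pullback_shear (n m : nat) (A : 'M[R]_n) (W U : 'M[R]_(n, m)) f :
    A *m W = W -> A *m U = U + W -> pullback A f = f ->
  forall j, (pullback W f)^`M(j) = 0.
Proof.
move=> AW AU Af j; pose D a := pullback W f^`M(a).
have gradD b : D b = \sum_(a < n) A a b *: D a.
  rewrite {1}/D -[in LHS]Af mderiv_pullback raddf_sum /=.
  by apply: eq_bigr => a _; rewrite linearZ /= pullback_comp AW.
have: \sum_(b < n) U b j *: D b = \sum_(a < n) (A *m U) a j *: D a.
  under eq_bigr => b _ do rewrite gradD scaler_sumr.
  rewrite exchange_big /=; apply: eq_bigr => a _.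
  by rewrite mxE scaler_suml; apply: eq_bigr => b _; rewrite scalerA mulrC.
rewrite AU; under [RHS]eq_bigr => a _ do rewrite mxE scalerDl.
rewrite big_split /= => /eqP; rewrite -subr_eq0 opprD addrA subrr add0r oppr_eq0.
by rewrite mderiv_pullback => /eqP.
Qed.

(** A squarefree monomial factors only into squarefree ones, and h has none:
    not 1, by the last hypothesis; and if X_i divides a squarefree monomial exactly once, then its coefficient in
    h occurs, with multiplicity 1, in the i-th partial derivative of h. *)
Lemma coef_mul_mderiv0 (m : nat) (q h : {mpoly R[m]}) (e : 'X_{1..m}) :
    (forall i, e i <= 1)%N -> (forall j, h^`M(j) = 0) -> h@_0 = 0 ->
  (q * h)@_e = 0.
Proof.
move=> e1 dh h0; rewrite mcoeffM big1 // => [[k1 k2]] /= /eqP ek.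
suff ->: h@_k2 = 0 by rewrite mulr0.
have [->//|k2n0] := eqVneq (k2 : 'X_{1..m}) 0%MM.
have [i k2i]: exists i, k2 i != 0%N.
  apply/existsP; apply: contraNT k2n0; rewrite negb_exists => /forallP k20.
  by apply/eqP/mnmP=> i; rewrite mnm0E; apply/eqP; rewrite -[_ == _]negbK.
have k2i1 : k2 i = 1%N.
  apply/eqP; rewrite eqn_leq lt0n k2i andbT (leq_trans _ (e1 i)) //.
  by rewrite (congr1 (fun d : 'X_{1..m} => d i) ek) mnmDE leq_addl.
have := congr1 (mcoeff (k2 - U_(i))%MM) (dh i).
rewrite mcoeff0 mcoeff_deriv mnmBE k2i1 mnm1E eqxx subnn mulr1n submK //.
by apply/mnm_lepP=> j; rewrite mnm1E; case: eqP => [<-|//]; rewrite k2i1.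
Qed.

End LinearSubstitution.

Section Shears.
Local Open Scope ring_scope.
Variables (F : fieldType) (gT : finGroupType) (G : {group gT}).

(** Each pair of matching columns of W and U spans a two-dimensional Jordan block
    of g.  Independence of the columns of W is expressed by a left inverse L, as
    its rows are the linear forms whose product is shown to be a nonzero
    coinvariant. *)
Definition has_shears (rho : representation F G) (g : gT) (m : nat) : Prop :=
  exists W U : 'M[F]_(rdegree rho, m), exists L : 'M[F]_(m, rdegree rho),
    [/\ rho g *m W = W, rho g *m U = U + W & L *m W = 1%:M].

Lemma has_shears_dadd (rho1 rho2 : representation F G) (g : gT) (m1 m2 : nat) :
    has_shears rho1 g m1 -> has_shears rho2 g m2 ->
  has_shears (dadd_grepr rho1 rho2) g (m1 + m2).
Proof.
move=> [W1 [U1 [L1 [gW1 gU1 LW1]]]] [W2 [U2 [L2 [gW2 gU2 LW2]]]].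
exists (block_mx W1 0 0 W2), (block_mx U1 0 0 U2), (block_mx L1 0 0 L2).
split; rewrite /= mulmx_block !mulmx0 !mul0mx !addr0 !add0r.
- by rewrite gW1 gW2.
- by rewrite gU1 gU2 add_block_mx !addr0.
by rewrite LW1 LW2 -scalar_mx_block.
Qed.

Lemma has_shears_muln (rho : representation F G) (g : gT) (m : nat) :
  has_shears rho g 1 -> has_shears (muln_grepr rho m) g m.
Proof.
move=> rho1; rewrite /muln_grepr; elim: m => [|m IHm].
  by rewrite big_ord0; exists 0, 0, 0; split; apply/matrixP=> [[]].
by rewrite big_ord_recl; apply: has_shears_dadd rho1 IHm.
Qed.

(** The vectors come from the last step of the nilpotent operator M = g - 1:
    when M^(k+2) = 0 and M^(k+1) != 0, a nonzero column w of M^(k+1) is killed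
    by M and is the image under M of the same column u of M^k. *)
Lemma pchar_has_shears (n p : nat) (V : mx_representation F G n) (g : gT) :
    mx_faithful V -> p \in [pchar F] -> g \in G -> #[g]%g = p ->
  has_shears (Representation V) g 1.
Proof.
move=> Vf charF Gg og.
have p_pr : prime p := pcharf_prime charF.
have Vg1 : V g != 1%:M.
  apply/eqP=> Vg1; move: p_pr; rewrite -og.
  suff /(subsetP Vf)/set1P->: g \in rker V by rewrite order1.
  by rewrite inE Gg Vg1 mul1mx eqxx.
case: n => [|n] in V Vf Vg1 *; first by case/eqP: Vg1; apply/matrixP=> [[]].
pose M : 'M[F]_n.+1 := V g - 1.
have charM : p \in [pchar 'M[F]_n.+1].
  apply/andP; split=> //; rewrite -scaler_nat (eqP (andP charF).2).
  by rewrite scale0r.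
have Mp : M ^+ p = 0.
  have := pFrobenius_autB_comm charM (commr1 (V g)).
  rewrite !pFrobenius_autE expr1n -repr_mxX // -og expg_order repr_mx1.
  by rewrite subrr.
have [k Mk0 kmin] := ex_minnP (ex_intro (fun k => M ^+ k == 0) p (introT eqP Mp)).
case: k => [|[|k]] in Mk0 kmin; first by rewrite expr0 oner_eq0 in Mk0.
  by rewrite expr1 subr_eq0 (negPf Vg1) in Mk0.
have [i [j Mij]] : exists i j, (M ^+ k.+1) i j != 0.
  have /matrix0Pn : M ^+ k.+1 != 0; last by [].
  by apply/negP=> /kmin; rewrite ltnn.
have VE : V g = M + 1 by rewrite subrK.
exists (col j (M ^+ k.+1)), (col j (M ^+ k)).
exists (((M ^+ k.+1) i j)^-1 *: delta_mx 0 i).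
split; rewrite /= ?VE.
- rewrite mulmxDl mul1mx !colE mulmxA -[M *m _]/(M * _) -exprS (eqP Mk0).
  by rewrite mul0mx add0r.
- by rewrite mulmxDl mul1mx !colE mulmxA -[M *m _]/(M * _) -exprS addrC.
apply/matrixP=> a b; rewrite !ord1 -scalemxAl -rowE !mxE eqxx.
by rewrite mulVf.
Qed.

Lemma topdeg_ge (n d : nat) (rG : mx_representation F G n) f :
  f \is d.-homog -> ~~ hilbert_ideal rG f -> (d <= topdeg rG)%N.
Proof.
move=> fd fI; rewrite /topdeg; case: ex_maxnP => t _; apply.
apply/asboolP; exists (coinv_class rG f); first by exists f.
by rewrite coinv_class_eq0.
Qed.

(** The product of the m linear forms given by the rows of L restricts along W
    to s_1 ... s_m, which is the restriction of no element of the Hilbert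
    ideal. *)
Lemma shears_topdeg (rho : representation F G) (g : gT) (m : nat) :
  g \in G -> has_shears rho g m -> (m <= topdeg rho)%N.
Proof.
move=> Gg [W [U [L [gW gU LW]]]].
pose f := \prod_(j < m) \sum_(a < rdegree rho) L j a *: ('X_a : {mpoly F[rdegree rho]}).
pose e : 'X_{1..m} := [multinom 1%N | _ < m].
have pf : pullback W f = 'X_[e].
  rewrite rmorph_prod mpolyXE_id; apply: eq_bigr => j _ /=.
  rewrite -pullbackX pullback_comp LW pullbackX (bigD1 j) //= big1 => [|i ij].
    by rewrite !mxE eqxx scale1r addr0 mnmE expr1.
  by rewrite mxE eq_sym (negPf ij) scale0r.
apply: (@topdeg_ge _ _ _ f).
  have -> : f = \prod_(h <- [tuple \sum_a L j a *: 'X_a | j < m]) h.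
    by rewrite big_tuple; apply: eq_bigr => j _; rewrite tnth_mktuple.
  have dm : (\sum_(i <- [tuple 1%N | _ < m]) i)%N = m.
    rewrite big_tuple (eq_bigr (fun=> 1%N)) => [|j _]; last by rewrite tnth_mktuple.
    by rewrite sum1_card card_ord.
  rewrite -[X in X.-homog]dm; apply: dhomog_prod => j; rewrite !tnth_mktuple.
  by apply: rpred_sum => a _; apply/dhomogZ; rewrite dhomogX /= mdeg1.
apply/asboolP=> [[k [q [h [hI fE]]]]].
have: (pullback W f)@_e = 1 by rewrite pf mcoeffX eqxx.
rewrite fE (raddf_sum (pullback W)) raddf_sum big1 => [/esym/eqP|i _].
  by rewrite oner_eq0.
rewrite /= rmorphM.
have /andP[/forall_inP hG h0] := hI i.
apply: coef_mul_mderiv0 => [j||]; first by rewrite mnmE.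
  apply: mderiv_pullback_shear gW gU _.
  (* [poly_act] substitutes the inverse, so invariance is used at g^-1. *)
  by have /eqP := hG g^-1%g (groupVr Gg); rewrite /poly_act /inv_subst invgK.
by rewrite pullback_coef0 (eqP h0).
Qed.

End Shears.

Theorem theorem8 (gT : finGroupType) (G : {group gT}) (F : fieldType)
    (n : nat) (V : mx_representation F G n) (p : nat)
    (V_faithful : mx_faithful V)
    (char_F : p \in [pchar F]%R)
    (p_dvd_G : p %| #|G|) :
  forall N : nat, exists m0 : nat, forall m : nat, m0 <= m ->
    N <= topdeg (muln_grepr (Representation V) m).
Proof.
move=> N; exists N => m leNm; apply: (leq_trans leNm).
have [g Gg og] := Cauchy (pcharf_prime char_F) p_dvd_G.
exact/(shears_topdeg Gg)/has_shears_muln/(pchar_has_shears V_faithful char_F Gg og).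
Qed.
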